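(* Let $n\ge2$ and let $V$ be an origami vertex of degree $2n$ all of whose sector angles equal $\pi/n$. Suppose $V$ rigidly folds, by a continuous rigid folding motion starting from the flat unfolded state, in the fully symmetric manner: the fold angles $\rho_0,\dots,\rho_{2n-1}$ of the creases in cyclic order satisfy $\rho_i=\rho_j$ whenever $i\equiv j\pmod 2$. Then the two common fold angles are proportional when measured by the tangent of a quarter of the fold angle, with constant of proportionality given by $p(\pi/n,\pi/2)$: at each state of the motion, naming the two common fold angles (of the even-indexed and of the odd-indexed creases) $\rho_a$ and $\rho_b$ in a suitable order, $$\tan\frac{\rho_b}{4}=-\,p\!\left(\frac{\pi}{n},\frac{\pi}{2}\right)\tan\frac{\rho_a}{4},\qquad p\!\left(\frac{\pi}{n},\frac{\pi}{2}\right)=\frac{1-\tan\frac{\pi}{2n}}{1+\tan\frac{\pi}{2n}} .$$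
   Context: An origami vertex of degree $2n$ is a crease pattern on a disk consisting of $2n$ creases that are radii emanating from the center; the sector angles are the angles between consecutive creases. A rigid folded state maps each sector isometrically to a planar sector in $\mathbb{R}^3$, fitting together along the creases into a homeomorphic image of the disk. The fold angle of a crease, in $[-\pi,\pi]$, is the signed angle between the normals of the images of its two incident sectors (zero: unfolded; positive: valley; negative: mountain). A rigid folding motion is a continuous path in the space of fold-angle vectors of rigid folded states. *)

(* Defs.v *)
From HB Require Import structures.
From mathcomp Require Import all_boot all_order all_algebra.
From mathcomp Require Import all_classical all_reals all_analysis.
Set Implicit Arguments.
Unset Strict Implicit.
Unset Printing Implicit Defensive.
Import Order.TTheory GRing.Theory Num.Theory.
Import numFieldNormedType.Exports.
Local Open Scope classical_set_scope.
Local Open Scope ring_scope.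

Definition dotv (R : realType) (k : nat) (u v : 'rV[R]_k) : R :=
  \sum_(i < k) u 0 i * v 0 i.

(* The norm `|u| that the library puts on row vectors is the max norm. *)
Definition enorm (R : realType) (k : nat) (u : 'rV[R]_k) : R :=
  Num.sqrt (dotv u u).

Definition vec2 (R : realType) (a b : R) : 'rV[R]_2 :=
  \row_(k < 2) [:: a; b]`_k.

Definition vec3 (R : realType) (a b c : R) : 'rV[R]_3 :=
  \row_(k < 3) [:: a; b; c]`_k.

Definition crossv (R : realType) (u v : 'rV[R]_3) : 'rV[R]_3 :=
  let u0 := u 0 (inord 0) in let u1 := u 0 (inord 1) in
  let u2 := u 0 (inord 2) in
  let v0 := v 0 (inord 0) in let v1 := v 0 (inord 1) in
  let v2 := v 0 (inord 2) in
  vec3 (u1 * v2 - u2 * v1) (u2 * v0 - u0 * v2) (u0 * v1 - u1 * v0).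

Definition det2 (R : realType) (x y : 'rV[R]_2) : R :=
  x 0 (inord 0) * y 0 (inord 1) - x 0 (inord 1) * y 0 (inord 0).

(* An origami vertex of degree m on the closed unit disk centred at the origin
   (any disk, up to a similarity).  The creases are numbered counterclockwise,
   crease 0 lies on the positive first axis, and sector i lies between crease i
   and its cyclic successor. *)
Record origami_vertex (R : realType) (m : nat) := OrigamiVertex {
  sector_angle : 'I_m -> R ;
  sector_angle_gt0 : forall i, 0 < sector_angle i ;
  sum_sector_angle : \sum_(i < m) sector_angle i = 2 * pi
}.

Definition disk (R : realType) : set 'rV[R]_2 := [set x | enorm x <= 1].

Definition polar (R : realType) (r phi : R) : 'rV[R]_2 :=
  vec2 (r * cos phi) (r * sin phi).

Definition crease_dir (R : realType) (m : nat) (V : origami_vertex R m)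
    (i : 'I_m) : R :=
  \sum_(j < m | (j < i)%N) sector_angle V j.

Definition crease_end (R : realType) (m : nat) (V : origami_vertex R m)
    (i : 'I_m) : 'rV[R]_2 :=
  polar 1 (crease_dir V i).

Definition sector (R : realType) (m : nat) (V : origami_vertex R m)
    (i : 'I_m) : set 'rV[R]_2 :=
  [set x | exists r phi : R,
    [/\ 0 <= r <= 1,
        crease_dir V i <= phi <= crease_dir V i + sector_angle V i &
        x = polar r phi]].

Definition homeo_onto_image (T U : topologicalType) (A : set T) (f : T -> U)
    : Prop :=
  {within A, continuous f} /\
  exists g : U -> T,
    (forall x, A x -> g (f x) = x) /\ {within f @` A, continuous g}.

(* Only the values of f on the disk matter.  Preserving Euclidean distances
   makes the image of a sector a congruent planar sector. *)
Record rigid_folded_state (R : realType) (m : nat) (V : origami_vertex R m)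
    (f : 'rV[R]_2 -> 'rV[R]_3) : Prop := RigidFoldedState {
  folded_isometric : forall i x y,
    sector V i x -> sector V i y -> enorm (f x - f y) = enorm (x - y) ;
  folded_homeo : homeo_onto_image (@disk R) f
}.

(* N is the unit normal of the image of sector i, on the side determined by the
   orientation of the paper. *)
Record sector_normal (R : realType) (m : nat) (V : origami_vertex R m)
    (f : 'rV[R]_2 -> 'rV[R]_3) (i : 'I_m) (N : 'rV[R]_3) : Prop :=
  SectorNormal {
  normal_unit : enorm N = 1 ;
  normal_orth : forall x y,
    sector V i x -> sector V i y -> dotv N (f x - f y) = 0 ;
  normal_oriented : forall x y,
    sector V i x -> sector V i y -> 0 < det2 x y ->
    0 < dotv (crossv (f x - f 0) (f y - f 0)) N
}.

(* rho is the angle of the rotation about the image of crease i, directed away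
   from the vertex, that takes the normal of sector i - 1 to that of sector i.
   With the normals of the flat paper pointing towards the viewer, rho > 0 for
   a valley and rho < 0 for a mountain. *)
Definition is_fold_angle (R : realType) (m : nat) (V : origami_vertex R m)
    (f : 'rV[R]_2 -> 'rV[R]_3) (i : 'I_m) (rho : R) : Prop :=
  - pi <= rho <= pi /\
  exists N N' : 'rV[R]_3,
    [/\ sector_normal V f (ord_pred i) N,
        sector_normal V f i N',
        cos rho = dotv N N' &
        sin rho = dotv (crossv N N') (f (crease_end V i) - f 0)].

Definition fold_angle_space (R : realType) (m : nat) (V : origami_vertex R m)
    : set 'rV[R]_m :=
  [set rho | exists2 f, rigid_folded_state V f &
                        forall i, is_fold_angle V f i (rho 0 i)].

Definition rigid_folding_motion (R : realType) (m : nat)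
    (V : origami_vertex R m) (gamma : R -> 'rV[R]_m) : Prop :=
  {within `[0, 1], continuous gamma} /\
  forall t, 0 <= t <= 1 -> fold_angle_space V (gamma t).

(* Main.v *)
(* Carry along the sectors the orthonormal frame formed by the image of the
   first crease, the unit normal and their cross product.  Passing to the next
   sector multiplies it by a rotation that depends only on the sector angle
   theta = pi/n and on the fold angle, so with alternating fold angles a, b the
   closing up of the paper says that the n-th power of one rotation is the
   identity.  Lifting to unit quaternions, the real part of the n-th power of q
   is T_n(w), with T_n the Chebyshev polynomial and
   w = cos theta cos(a/2) cos(b/2) - sin(a/2) sin(b/2) the real part of q;
   hence T_n(w)^2 = 1.  This leaves finitely many values of w, so w is constant
   along the motion and equals its value cos theta at the flat state.  In terms
   of x = tan(a/4), y = tan(b/4), tau = tan(theta/2), the equation w = cos theta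
   reads ((1 + tau) y + (1 - tau) x) ((1 + tau) x + (1 - tau) y) = 0. *)
Require Import Defs.
From HB Require Import structures.
From mathcomp Require Import all_boot all_order all_algebra.
From mathcomp Require Import all_classical all_reals all_analysis.
From mathcomp Require Import ring lra zify.
Import Order.TTheory GRing.Theory Num.Theory.
Import numFieldNormedType.Exports.
Local Open Scope classical_set_scope.
Local Open Scope ring_scope.
Set Implicit Arguments.
Unset Strict Implicit.

(** * Quaternions and Chebyshev polynomials *)

Record quat (R : Type) := Quat { qre : R; qi : R; qj : R; qk : R }.

Definition qmul (R : comNzRingType) (p q : quat R) : quat R :=
  let: Quat a b c d := p in let: Quat a' b' c' d' := q in
  Quat (a * a' - b * b' - c * c' - d * d')
         (a * b' + b * a' + c * d' - d * c')
         (a * c' - b * d' + c * a' + d * b')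
         (a * d' + b * c' - c * b' + d * a').

Definition qone (R : comNzRingType) : quat R := Quat 1 0 0 0.

Definition qnorm2 (R : comNzRingType) (q : quat R) : R :=
  let: Quat a b c d := q in a ^+ 2 + b ^+ 2 + c ^+ 2 + d ^+ 2.

Definition mx3 (R : nzRingType) (a b c d e f g h k : R) : 'M[R]_3 :=
  \matrix_(i < 3, j < 3) (nth [::] [:: [:: a; b; c]; [:: d; e; f]; [:: g; h; k]] i)`_j.

(** For a unit [q] this is the matrix of [v -> q v q^-1]. Without normalisation its entries are
    quadratic forms, so multiplicativity is a polynomial identity in all quaternions. *)
Definition rotmx (R : comNzRingType) (q : quat R) : 'M[R]_3 :=
  let: Quat w x y z := q in
  mx3 (w ^+ 2 + x ^+ 2 - y ^+ 2 - z ^+ 2) (2 * (x * y - w * z)) (2 * (x * z + w * y))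
    (2 * (x * y + w * z)) (w ^+ 2 - x ^+ 2 + y ^+ 2 - z ^+ 2) (2 * (y * z - w * x))
    (2 * (x * z - w * y)) (2 * (y * z + w * x)) (w ^+ 2 - x ^+ 2 - y ^+ 2 + z ^+ 2).

Lemma mx3_mul (R : nzRingType) (a b c d e f g h k a' b' c' d' e' f' g' h' k' : R) :
  mx3 a b c d e f g h k *m mx3 a' b' c' d' e' f' g' h' k' =
  mx3 (a * a' + b * d' + c * g') (a * b' + b * e' + c * h') (a * c' + b * f' + c * k')
      (d * a' + e * d' + f * g') (d * b' + e * e' + f * h') (d * c' + e * f' + f * k')
      (g * a' + h * d' + k * g') (g * b' + h * e' + k * h') (g * c' + h * f' + k * k').
Proof.
by apply/matrixP=> -[[|[|[|//]]] ?] [[|[|[|//]]] ?];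
  rewrite !mxE !big_ord_recl big_ord0 !mxE /= addr0 addrA.
Qed.

Lemma rotmxM (R : comNzRingType) (p q : quat R) :
  rotmx (qmul p q) = rotmx p *m rotmx q.
Proof.
by case: p q => [a b c d] [a' b' c' d']; rewrite /= mx3_mul; congr mx3; ring.
Qed.

Lemma rotmx1 (R : comNzRingType) : rotmx (qone R) = 1%:M.
Proof.
by apply/matrixP=> -[[|[|[|//]]] ?] [[|[|[|//]]] ?]; rewrite !mxE /=; ring.
Qed.

Lemma mxtrace_rotmx (R : comNzRingType) (q : quat R) :
  \tr (rotmx q) = 4 * qre q ^+ 2 - qnorm2 q.
Proof.
by case: q => a b c d; rewrite /mxtrace !big_ord_recl big_ord0 !mxE /=; ring.
Qed.

Lemma qnorm2M (R : comNzRingType) (p q : quat R) :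
  qnorm2 (qmul p q) = qnorm2 p * qnorm2 q.
Proof. by case: p q => [a b c d] [a' b' c' d'] /=; ring. Qed.

(** Every quaternion satisfies [p^2 = 2 re(p) p - |p|^2]; multiply by [q] and take real parts. For a
    unit [p] this is the Chebyshev recurrence. *)
Lemma qre_mul2 (R : comNzRingType) (p q : quat R) :
  qre (qmul p (qmul p q)) =
  2 * qre p * qre (qmul p q) - qnorm2 p * qre q.
Proof. by case: p q => [a b c d] [a' b' c' d'] /=; ring. Qed.

Definition qexp (R : comNzRingType) (q : quat R) (k : nat) : quat R :=
  iter k (qmul q) (qone R).

Lemma qnorm2X (R : comNzRingType) (q : quat R) k :
  qnorm2 q = 1 -> qnorm2 (qexp q k) = 1.
Proof.
move=> q1; elim: k => [|k IH]; first by rewrite /= ; ring.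
by rewrite /qexp iterS qnorm2M q1 mul1r.
Qed.

Fixpoint chebT (R : comNzRingType) (k : nat) : {poly R} :=
  match k with
  | 0 => 1
  | k'.+1 => match k' with
    | 0 => 'X
    | m.+1 => 2%:P * 'X * chebT R k' - chebT R m
    end
  end.

Lemma chebTSS (R : comNzRingType) k :
  chebT R k.+2 = 2%:P * 'X * chebT R k.+1 - chebT R k.
Proof. by []. Qed.

Lemma qre_exp (R : comNzRingType) (q : quat R) k : qnorm2 q = 1 ->
  qre (qexp q k) = (chebT R k).[qre q].
Proof.
move=> q1.
(* The recurrence has order two, so two consecutive exponents go through the induction together. *)
suff [//] : qre (qexp q k) = (chebT R k).[qre q] /\
  qre (qexp q k.+1) = (chebT R k.+1).[qre q].
elim: k => [|k [IH1 IH2]].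
  by rewrite /= hornerX hornerE; split => //; case: q {q1} => * /=; ring.
split => //; rewrite chebTSS !hornerE -IH1 -IH2 /qexp !iterS qre_mul2 q1.
by rewrite mul1r.
Qed.

(* [T_k] is unbounded off [[-1, 1]], so that [T_k ^ 2 - 1] is not zero. *)
Lemma chebT2_gt1 (R : numDomainType) k : 1 < (chebT R k.+1).[2].
Proof.
suff [//] : 1 < (chebT R k.+1).[2] /\ (chebT R k).[2] < (chebT R k.+1).[2].
elim: k => [|k [IH1 IH2]]; first by rewrite /= !hornerE ltr1n.
rewrite chebTSS !hornerE.
set u := (chebT R k.+1).[2] in IH1 IH2 *; set v := (chebT R k).[2] in IH2 *.
have h : u < 2 * 2 * u - v.
  rewrite -subr_gt0 (_ : _ - _ = (u - v) + (u + u)); last by ring.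
  by rewrite addr_gt0 ?subr_gt0 // addr_gt0 // (lt_trans ltr01).
by split => //; apply: lt_trans h.
Qed.

Lemma chebT_sqr_neq1 (R : numDomainType) k : (0 < k)%N -> chebT R k ^+ 2 - 1 != 0.
Proof.
case: k => // k _; apply/eqP => /(congr1 (fun p : {poly R} => p.[2])).
rewrite !hornerE => /eqP; rewrite subr_eq0 => /eqP h.
have := @chebT2_gt1 R k.
by move/(exprn_egt1 2); rewrite h ltxx.
Qed.

(** Otherwise [f] would take all values between [f a] and [f b], and [p] would have infinitely many
    roots. *)
Lemma continuous_poly_root_const (R : realType) (p : {poly R}) (f : R -> R) (a b : R) :
  a <= b -> p != 0 -> {within `[a, b], continuous f} ->
  (forall x, a <= x <= b -> p.[f x] = 0) -> f a = f b.
Proof.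
move=> ab p0 cf pf; apply/eqP/negPn/negP => fab.
(* These points are pairwise distinct and lie between the two end values; [size p] of them are
   already too many roots for a nonzero [p]. *)
pose v k := f a + (f b - f a) * k.+1%:R^-1.
have vroot k : root p (v k).
  have k0 : 0 < k.+1%:R^-1 :> R by rewrite invr_gt0.
  have k1 : k.+1%:R^-1 <= 1 :> R by rewrite invf_le1 // ler1n.
  have [c + <-] : exists2 c, c \in `[a, b]%R & f c = v k.
    apply: IVT => //; rewrite /v; set x := _^-1 in k0 k1 *.
    rewrite ge_min le_max; case: (leP (f a) (f b)) => h.
      by apply/andP; split; apply/orP; [left|right]; nra.
    by apply/andP; split; apply/orP; [right|left]; nra.
  by rewrite in_itv => /= cab; apply/rootP/pf.
have := max_poly_roots p0 (rs := mkseq v (size p)).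
rewrite size_mkseq ltnn => h; apply: notF; apply: h.
  by apply/allP => _ /mapP[k _ ->].
rewrite mkseq_uniq // => i j /addrI /mulfI; rewrite subr_eq0 eq_sym.
by move=> /(_ fab) /invr_inj /eqP; rewrite eqr_nat eqSS => /eqP.
Qed.

(** * Frames in Euclidean space *)

Section Dotv.
Variables (R : realType) (k : nat).
Implicit Types (u v w : 'rV[R]_k) (a : R).

Lemma dotvC u v : dotv u v = dotv v u.
Proof. by apply: eq_bigr => i _; rewrite mulrC. Qed.

Lemma dotvDl u v w : dotv (u + v) w = dotv u w + dotv v w.
Proof. by rewrite -big_split; apply: eq_bigr => i _; rewrite mxE mulrDl. Qed.

Lemma dotvZl a u w : dotv (a *: u) w = a * dotv u w.
Proof. by rewrite mulr_sumr; apply: eq_bigr => i _; rewrite mxE mulrA. Qed.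

Lemma dotvNl u w : dotv (- u) w = - dotv u w.
Proof. by rewrite -scaleN1r dotvZl mulN1r. Qed.

Lemma dotvDr u v w : dotv w (u + v) = dotv w u + dotv w v.
Proof. by rewrite !(dotvC w) dotvDl. Qed.

Lemma dotvZr a u w : dotv w (a *: u) = a * dotv w u.
Proof. by rewrite !(dotvC w) dotvZl. Qed.

Lemma dotvNr u w : dotv w (- u) = - dotv w u.
Proof. by rewrite !(dotvC w) dotvNl. Qed.

Lemma dotv_ge0 u : 0 <= dotv u u.
Proof. by apply: sumr_ge0 => i _; rewrite -expr2 sqr_ge0. Qed.

Lemma dotv_eq0 u : dotv u u = 0 -> u = 0.
Proof.
move=> h; apply/rowP => i; rewrite mxE; apply/eqP.
have /(_ h i isT) /eqP := @psumr_eq0P _ _ xpredT (fun i => u 0 i * u 0 i)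
  (fun j _ => sqr_ge0 (u 0 j)).
by rewrite mulf_eq0 orbb.
Qed.


End Dotv.

Lemma enorm_eq (R : realType) (j k : nat) (u : 'rV[R]_j) (v : 'rV[R]_k) :
  enorm u = enorm v -> dotv u u = dotv v v.
Proof. by move/(congr1 (fun x => x ^+ 2)); rewrite !sqr_sqrtr ?dotv_ge0. Qed.

Lemma enorm_eq1 (R : realType) (k : nat) (u : 'rV[R]_k) :
  enorm u = 1 -> dotv u u = 1.
Proof. by move=> u1; rewrite -(sqr_sqrtr (dotv_ge0 u)) -/(enorm u) u1 expr1n. Qed.

Lemma dotv2E (R : realType) (u v : 'rV[R]_2) : dotv u v =
  u 0 (inord 0) * v 0 (inord 0) + u 0 (inord 1) * v 0 (inord 1).
Proof.
rewrite /dotv !big_ord_recl big_ord0 addr0.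
by congr (u _ _ * v _ _ + u _ _ * v _ _); apply/val_inj; rewrite /= inordK.
Qed.

Lemma dotv3E (R : realType) (u v : 'rV[R]_3) : dotv u v =
  u 0 (inord 0) * v 0 (inord 0) + u 0 (inord 1) * v 0 (inord 1)
  + u 0 (inord 2) * v 0 (inord 2).
Proof.
rewrite /dotv !big_ord_recl big_ord0 addr0 addrA.
by congr (u _ _ * v _ _ + u _ _ * v _ _ + u _ _ * v _ _);
  apply/val_inj; rewrite /= inordK.
Qed.

Lemma row3P (R : realType) (u v : 'rV[R]_3) :
  u 0 (inord 0) = v 0 (inord 0) -> u 0 (inord 1) = v 0 (inord 1) ->
  u 0 (inord 2) = v 0 (inord 2) -> u = v.
Proof.
move=> h0 h1 h2; apply/rowP => i; rewrite -(inord_val i).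
by case: i => -[|[|[|//]]].
Qed.

Lemma vec3_0 (R : realType) (a b c : R) : vec3 a b c 0 (inord 0) = a.
Proof. by rewrite mxE inordK. Qed.
Lemma vec3_1 (R : realType) (a b c : R) : vec3 a b c 0 (inord 1) = b.
Proof. by rewrite mxE inordK. Qed.
Lemma vec3_2 (R : realType) (a b c : R) : vec3 a b c 0 (inord 2) = c.
Proof. by rewrite mxE inordK. Qed.
Definition vec3E := (vec3_0, vec3_1, vec3_2).

Section Crossv.
Variable R : realType.
Implicit Types (u v w : 'rV[R]_3) (a : R).

Lemma crossvC u v : crossv u v = - crossv v u.
Proof. by apply: row3P; rewrite [RHS]mxE !vec3E; ring. Qed.

Lemma crossvDl u v w : crossv (u + v) w = crossv u w + crossv v w.
Proof. by apply: row3P; rewrite [RHS]mxE !vec3E !mxE; ring. Qed.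

Lemma crossvZl a u w : crossv (a *: u) w = a *: crossv u w.
Proof. by apply: row3P; rewrite [RHS]mxE !vec3E !mxE; ring. Qed.

Lemma crossvDr u v w : crossv w (u + v) = crossv w u + crossv w v.
Proof. by apply: row3P; rewrite [RHS]mxE !vec3E !mxE; ring. Qed.

Lemma crossvZr a u w : crossv w (a *: u) = a *: crossv w u.
Proof. by apply: row3P; rewrite [RHS]mxE !vec3E !mxE; ring. Qed.

Lemma double_crossv u v w :
  crossv (crossv u v) w = dotv u w *: v - dotv v w *: u.
Proof. by apply: row3P; rewrite !vec3E !mxE !dotv3E; ring. Qed.

Lemma dotv_crossvl u v : dotv (crossv u v) u = 0.
Proof. by rewrite dotv3E !vec3E; ring. Qed.

Lemma dotv_crossvr u v : dotv (crossv u v) v = 0.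
Proof. by rewrite dotv3E !vec3E; ring. Qed.

Lemma dotv_crossv_crossv u v :
  dotv (crossv u v) (crossv u v) = dotv u u * dotv v v - dotv u v ^+ 2.
Proof. by rewrite !dotv3E !vec3E; ring. Qed.

(** The right-hand side is the expanded Gram determinant of [u], [v], [w]. *)
Lemma crossv_gram u v w : dotv (crossv u v) w ^+ 2 =
  dotv u u * dotv v v * dotv w w + 2 * dotv u v * dotv v w * dotv u w
  - dotv u u * dotv v w ^+ 2 - dotv v v * dotv u w ^+ 2 - dotv w w * dotv u v ^+ 2.
Proof. by rewrite !dotv3E !vec3E; ring. Qed.

Lemma dotv_crossvCA u v w : dotv u (crossv v w) = - dotv (crossv v u) w.
Proof. by rewrite !dotv3E !vec3E; ring. Qed.

(** The Gram determinant gives the triple product up to sign, and positivity makes it [s]. Then the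
    difference of the two sides has squared length zero. *)
Lemma unit_normalE u v w (s : R) : 0 < s ->
  dotv u u = 1 -> dotv v v = 1 -> dotv u v ^+ 2 = 1 - s ^+ 2 ->
  dotv w w = 1 -> dotv w u = 0 -> dotv w v = 0 -> 0 < dotv (crossv u v) w ->
  w = s^-1 *: crossv u v.
Proof.
move=> s0 uu vv uv ww wu wv cw.
have cs : dotv (crossv u v) w = s.
  apply/eqP; rewrite -(@eqrXn2 _ 2) ?ltW // crossv_gram uv uu vv ww.
  by rewrite (dotvC u w) (dotvC v w) wu wv; apply/eqP; ring.
apply/eqP; rewrite -subr_eq0; apply/eqP/dotv_eq0.
rewrite !(dotvDl, dotvDr, dotvNl, dotvNr, dotvZl, dotvZr) (dotvC w) cs.
rewrite dotv_crossv_crossv uu vv uv ww.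
by field; rewrite gt_eqF.
Qed.

(** This is Rodrigues' formula for a vector [u] orthogonal to the axis [w]. The difference of the
    two sides has squared length [1 - (c^2 + s^2)]. *)
Lemma rotated_normalE u v w (c s : R) :
  dotv u u = 1 -> dotv v v = 1 -> dotv w w = 1 -> dotv u w = 0 -> dotv v w = 0 ->
  c ^+ 2 + s ^+ 2 = 1 -> c = dotv u v -> s = dotv (crossv u v) w ->
  v = c *: u - s *: crossv u w.
Proof.
move=> uu vv ww uw vw cs1 cE sE.
apply/eqP; rewrite -subr_eq0; apply/eqP/dotv_eq0.
rewrite !(dotvDl, dotvDr, dotvNl, dotvNr, dotvZl, dotvZr).
rewrite dotv_crossv_crossv (dotvC u (crossv _ _)) dotv_crossvl.
rewrite (dotvC (crossv u w) v) dotv_crossvCA -sE (dotvC v u) -cE uu vv ww uw.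
by transitivity (1 - (c ^+ 2 + s ^+ 2)); [ring | rewrite cs1 subrr].
Qed.

(** The vectors are rows, so a rotation expressed in the moving frame multiplies on the left. The
    order makes the basis right-handed when [u] and [w] are orthonormal. *)
Definition frame u w : 'M[R]_3 :=
  \matrix_(i < 3, j < 3) (nth 0 [:: u; crossv w u; w] i) 0 j.

Lemma mx3_mul_frame (a b c d e f g h k : R) u w u' w' :
  u' = a *: u + b *: crossv w u + c *: w ->
  crossv w' u' = d *: u + e *: crossv w u + f *: w ->
  w' = g *: u + h *: crossv w u + k *: w ->
  frame u' w' = mx3 a b c d e f g h k *m frame u w.
Proof.
move=> hu hc hw; apply/matrixP => i j.
rewrite !mxE !big_ord_recl big_ord0 !mxE /= addr0 addrA.
by case: i => -[|[|[|//]]] ? /=; rewrite ?hc ?hu ?hw !mxE.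
Qed.

(* The composite of the rotation by half angle [(c, s)] within the sector and
   of the rotation by half angle [(C, S)] about the next crease. *)
Definition fold_quat (c s C S : R) : quat R :=
  Quat (C * c) (- (S * c)) (- (S * s)) (- (C * s)).

Lemma rotmx_fold_quat (c s C S : R) : rotmx (fold_quat c s C S) =
  mx3 ((c ^+ 2 - s ^+ 2) * (C ^+ 2 + S ^+ 2)) (2 * c * s * (C ^+ 2 + S ^+ 2)) 0
      (- ((C ^+ 2 - S ^+ 2) * (2 * c * s))) ((C ^+ 2 - S ^+ 2) * (c ^+ 2 - s ^+ 2))
        (2 * C * S * (c ^+ 2 + s ^+ 2))
      (2 * C * S * (2 * c * s)) (- (2 * C * S * (c ^+ 2 - s ^+ 2)))
        ((C ^+ 2 - S ^+ 2) * (c ^+ 2 + s ^+ 2)).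
Proof. by rewrite /rotmx /=; congr mx3; ring. Qed.

(** First [u] turns about [w] within the sector, then [w] turns about the new crease [u']. Since
    rows carry the transposed rotations, the quaternion is the product [(C - S i)(c - s k)] with
    minus signs. *)
Lemma frame_step (c s C S : R) u w u' w' :
  c ^+ 2 + s ^+ 2 = 1 -> C ^+ 2 + S ^+ 2 = 1 ->
  dotv u u = 1 -> dotv w w = 1 -> dotv u w = 0 ->
  u' = (c ^+ 2 - s ^+ 2) *: u + (2 * c * s) *: crossv w u ->
  w' = (C ^+ 2 - S ^+ 2) *: w - (2 * C * S) *: crossv w u' ->
  frame u' w' = rotmx (fold_quat c s C S) *m frame u w.
Proof.
move=> cs CS uu ww uw hu hw.
rewrite rotmx_fold_quat cs CS !mulr1.
set c2 := c ^+ 2 - s ^+ 2 in hu *; set s2 := 2 * c * s in hu *.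
set C2 := C ^+ 2 - S ^+ 2 in hw *; set S2 := 2 * C * S in hw *.
have c2s2 : c2 ^+ 2 + s2 ^+ 2 = 1 by rewrite -[RHS]mulr1 -{1}cs -cs /c2 /s2; ring.
have wu' : crossv w u' = c2 *: crossv w u - s2 *: u.
  rewrite hu crossvDr !crossvZr (crossvC w (crossv _ _)) double_crossv ww uw.
  by rewrite scale0r scale1r subr0 scalerN.
have u'u' : dotv u' u' = 1.
  rewrite hu !(dotvDl, dotvDr, dotvNl, dotvNr, dotvZl, dotvZr).
  rewrite dotv_crossv_crossv (dotvC u (crossv _ _)) dotv_crossvr uu ww (dotvC w u) uw.
  by rewrite -[RHS]c2s2; ring.
have wu'0 : dotv w u' = 0.
  by rewrite hu dotvDr !dotvZr (dotvC w u) uw (dotvC w) dotv_crossvl; ring.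
apply: mx3_mul_frame.
- by rewrite hu scale0r addr0.
- rewrite hw crossvDl -scaleNr !crossvZl double_crossv wu'0 u'u' wu'.
  by rewrite scale0r sub0r scale1r; apply/rowP => j; rewrite !mxE; ring.
- by rewrite hw wu'; apply/rowP => j; rewrite !mxE; ring.
Qed.

(* [F = rot(q) F] forces [tr rot(q) = 3] when the frame [F] is orthonormal. *)
Lemma qre_frame_fixed (q : quat R) u w : qnorm2 q = 1 ->
  dotv u u = 1 -> dotv w w = 1 -> dotv u w = 0 ->
  frame u w = rotmx q *m frame u w -> qre q ^+ 2 = 1.
Proof.
move=> q1 uu ww uw h.
have FF : frame u w *m (frame u w)^T = 1%:M.
  have FE i j : (frame u w *m (frame u w)^T) i j =
      dotv (nth 0 [:: u; crossv w u; w] i) (nth 0 [:: u; crossv w u; w] j).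
    by rewrite mxE; apply: eq_bigr => k _; rewrite !mxE.
  apply/matrixP=> i j; rewrite FE.
  case: i j => -[|[|[|//]]] ? [[|[|[|//]]] ?]; rewrite !mxE /= ?uu ?ww ?uw //;
    rewrite ?(dotvC w u) ?uw ?(dotvC _ (crossv _ _)) ?dotv_crossvl ?dotv_crossvr //.
  by rewrite dotv_crossv_crossv uu ww (dotvC w) uw; ring.
(* Orthonormality makes the frame invertible, so it cancels from the fixed-point equation. *)
have r1 : rotmx q = 1%:M by rewrite -[LHS]mulmx1 -FF mulmxA -h.
have := mxtrace_rotmx q; rewrite r1 q1 mxtrace1 => h3.
by lra.
Qed.

End Crossv.

(** * Folded sectors *)

Lemma cos_half (R : realType) (x : R) :
  cos x = cos (x / 2) ^+ 2 - sin (x / 2) ^+ 2.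
Proof. by rewrite [in LHS](splitr x) cosD !expr2. Qed.

Lemma sin_half (R : realType) (x : R) :
  sin x = 2 * cos (x / 2) * sin (x / 2).
Proof. by rewrite [in LHS](splitr x) sinD; ring. Qed.

Lemma polar_0 (R : realType) (phi : R) : polar 0 phi = 0.
Proof. by apply/rowP => i; rewrite !mxE !mul0r; case: i => -[|[|]]. Qed.

Lemma polar_1E (R : realType) (phi : R) :
  (polar 1 phi 0 (inord 0) = cos phi) * (polar 1 phi 0 (inord 1) = sin phi).
Proof. by split; rewrite mxE inordK //= mul1r. Qed.

Section Sector.
Variables (R : realType) (m : nat) (V : origami_vertex R m).
Variables (f : 'rV[R]_2 -> 'rV[R]_3) (rf : rigid_folded_state V f).

Definition folded_ray (phi : R) : 'rV[R]_3 := f (polar 1 phi) - f 0.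

Definition in_sector (i : 'I_m) (phi : R) :=
  crease_dir V i <= phi <= crease_dir V i + sector_angle V i.

Lemma in_sector_l i : in_sector i (crease_dir V i).
Proof. by rewrite /in_sector lexx lerDl ltW // sector_angle_gt0. Qed.

Lemma in_sector_r i : in_sector i (crease_dir V i + sector_angle V i).
Proof. by rewrite /in_sector lexx lerDl ltW // sector_angle_gt0. Qed.

Lemma sector_polar i phi : in_sector i phi -> sector V i (polar 1 phi).
Proof. by move=> h; exists 1, phi; split; rewrite ?ler01 ?lexx. Qed.

Lemma sector_0 i : sector V i 0.
Proof.
exists 0, (crease_dir V i); rewrite polar_0; split => //.
  by rewrite lexx ler01.
exact: in_sector_l.
Qed.

(** Polarisation: the vertex lies in every sector, so the three distances among [x], [y] and [0] are
    preserved, and they determine the inner product. *)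
Lemma dotv_folded i x y : sector V i x -> sector V i y ->
  dotv (f x - f 0) (f y - f 0) = dotv x y.
Proof.
move=> sx sy; have s0 := sector_0 i.
have hx := enorm_eq (folded_isometric rf sx s0).
have hy := enorm_eq (folded_isometric rf sy s0).
have hxy := enorm_eq (folded_isometric rf sx sy).
have E : f x - f y = (f x - f 0) - (f y - f 0) by rewrite opprB addrA subrK.
move: hx hy hxy; rewrite E !subr0.
move: (f x - f 0) (f y - f 0) => u v.
rewrite !(dotvDl, dotvDr, dotvNl, dotvNr) (dotvC v u) (dotvC y x) => -> ->.
by lra.
Qed.

Lemma dotv_folded_ray i phi psi : in_sector i phi -> in_sector i psi ->
  dotv (folded_ray phi) (folded_ray psi) = cos (psi - phi).
Proof.
move=> h1 h2; rewrite (dotv_folded (sector_polar h1) (sector_polar h2)).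
by rewrite dotv2E !polar_1E cosB; ring.
Qed.

(** The two bounding creases span the plane of the image. Their planar determinant is the sine of
    the sector angle, so the orientation condition applies to them and fixes the sign. *)
Lemma sector_normalE i (N : 'rV[R]_3) : 0 < sin (sector_angle V i) ->
  sector_normal V f i N ->
  N = (sin (sector_angle V i))^-1 *: crossv (folded_ray (crease_dir V i))
    (folded_ray (crease_dir V i + sector_angle V i)).
Proof.
move=> s0 [N1 Nort Nor].
have il := in_sector_l i; have ir := in_sector_r i.
apply: unit_normalE => //.
- by rewrite (dotv_folded_ray il il) subrr cos0.
- by rewrite (dotv_folded_ray ir ir) subrr cos0.
- by rewrite (dotv_folded_ray il ir) addrC addKr cos2sin2.
- exact: enorm_eq1.
- by apply: Nort (sector_polar il) (sector_0 i).
- by apply: Nort (sector_polar ir) (sector_0 i).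
- apply: Nor (sector_polar il) (sector_polar ir) _.
  rewrite /det2 !polar_1E; set d := crease_dir V i.
  suff -> : cos d * sin (d + sector_angle V i) - sin d * cos (d + sector_angle V i) =
    sin (sector_angle V i) by [].
  by rewrite sinD cosD -[RHS]mul1r -(cos2Dsin2 d); ring.
Qed.

End Sector.

(** * Transport of the frame around a vertex with equal sector angles *)

Section EqualAngles.
Variables (R : realType) (m : nat) (V : origami_vertex R m) (theta : R).
Hypotheses (hV : forall i, sector_angle V i = theta) (sin_theta : 0 < sin theta).
Variables (f : 'rV[R]_2 -> 'rV[R]_3) (rf : rigid_folded_state V f).

(** Natural numbers replace cyclic indices, so that induction can walk around the vertex; the return
    to the start becomes periodicity. *)
Definition crease_image (k : nat) : 'rV[R]_3 := folded_ray f (k%:R * theta).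

Definition normal_image (k : nat) : 'rV[R]_3 :=
  (sin theta)^-1 *: crossv (crease_image k) (crease_image k.+1).

Definition sector_frame (k : nat) := frame (crease_image k) (normal_image k).

Lemma crease_dirE (i : 'I_m) : crease_dir V i = i%:R * theta.
Proof.
rewrite /crease_dir (eq_bigr (fun=> theta)) //.
rewrite -(big_ord_widen m (fun=> theta)) ?(ltnW (ltn_ord i)) //.
by rewrite sumr_const card_ord mulr_natl.
Qed.

Lemma total_angle : m%:R * theta = 2 * pi.
Proof.
rewrite -(sum_sector_angle V) (eq_bigr (fun=> theta)) //.
by rewrite sumr_const card_ord mulr_natl.
Qed.

Lemma crease_image_period k : crease_image (k + m) = crease_image k.
Proof.
rewrite /crease_image /folded_ray natrD mulrDl total_angle (mulr_natl pi).
by rewrite /polar cosD2pi sinD2pi.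
Qed.

Lemma normal_image_period k : normal_image (k + m) = normal_image k.
Proof. by rewrite /normal_image -addSn !crease_image_period. Qed.

Lemma crease_imageS (k : 'I_m) :
  crease_image k.+1 = folded_ray f (crease_dir V k + sector_angle V k).
Proof. by rewrite /crease_image crease_dirE hV -natr1 mulrDl mul1r. Qed.

Lemma crease_image_dir (k : 'I_m) :
  crease_image k = folded_ray f (crease_dir V k).
Proof. by rewrite /crease_image crease_dirE. Qed.

Lemma crease_image_dots (k : 'I_m) :
  [/\ dotv (crease_image k) (crease_image k) = 1,
      dotv (crease_image k.+1) (crease_image k.+1) = 1 &
      dotv (crease_image k) (crease_image k.+1) = cos theta].
Proof.
rewrite crease_imageS crease_image_dir.
have il := in_sector_l V k; have ir := in_sector_r V k.
split; rewrite (dotv_folded_ray rf _ _ (i := k)) // ?subrr ?cos0 //.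
by rewrite addrC addKr hV.
Qed.

Lemma normal_imageE (k : 'I_m) N : sector_normal V f k N -> N = normal_image k.
Proof.
move=> h; rewrite /normal_image crease_imageS crease_image_dir.
by rewrite (sector_normalE rf _ h) hV.
Qed.

Lemma ordS_periodic (T : Type) (F : nat -> T) (k : 'I_m) :
  (forall j, F (j + m)%N = F j) -> F (ordS k) = F k.+1.
Proof.
move=> Fm; rewrite /=; have := ltn_ord k; rewrite leq_eqVlt => /orP[/eqP e|h].
  by rewrite e modnn -[in RHS]e -{1}(add0n k.+1) e Fm.
by rewrite modn_small.
Qed.

Lemma sector_frameS (k : 'I_m) (rho : R) : is_fold_angle V f (ordS k) rho ->
  sector_frame k.+1 = rotmx (fold_quat (cos (theta / 2)) (sin (theta / 2))
    (cos (rho / 2)) (sin (rho / 2))) *m sector_frame k.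
Proof.
move=> [_ [N [N' [+ hN' cE sE]]]]; rewrite ordSK => hN.
have NN : dotv N N = 1 by exact: enorm_eq1 (normal_unit hN).
have NN' : dotv N' N' = 1 by exact: enorm_eq1 (normal_unit hN').
have NE := normal_imageE hN.
have NE' : N' = normal_image k.+1.
  by rewrite (normal_imageE hN'); apply: ordS_periodic normal_image_period.
have eE : f (crease_end V (ordS k)) - f 0 = crease_image k.+1.
  by rewrite -(ordS_periodic _ crease_image_period) crease_image_dir.
have [uu vv uv] := crease_image_dots k.
rewrite eE in sE.
apply: frame_step; rewrite ?cos2Dsin2 // -?NE -?NE' //.
- by rewrite NE dotvZr dotvC dotv_crossvl mulr0.
(* With [u], [v] the images of creases [k] and [k + 1], the term [sin theta *: crossv N u] is
   [(u x v) x u = v - cos theta u]. *)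
- rewrite -cos_half -sin_half NE crossvZl scalerA mulfV ?gt_eqF // scale1r.
  rewrite double_crossv uu scale1r (dotvC (crease_image k.+1)) uv.
  by rewrite addrC subrK.
(* The axis is the crease shared by both sectors, hence orthogonal to both normals. *)
- rewrite -cos_half -sin_half; apply: rotated_normalE => //.
  + by rewrite NE dotvZl dotv_crossvr mulr0.
  + by rewrite NE' dotvZl dotv_crossvl mulr0.
  + by rewrite cos2Dsin2.
Qed.

End EqualAngles.

Lemma qnorm2_fold_quat (R : realType) (c s C S : R) :
  c ^+ 2 + s ^+ 2 = 1 -> C ^+ 2 + S ^+ 2 = 1 -> qnorm2 (fold_quat c s C S) = 1.
Proof. by move=> h1 h2; rewrite -[RHS]mulr1 -{1}h1 -h2 /=; ring. Qed.

Definition half_turn_cos (R : realType) (theta a b : R) : R :=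
  cos theta * cos (a / 2) * cos (b / 2) - sin (a / 2) * sin (b / 2).

(* [half_turn_cos] is the real part of the product of the two quaternions that
   advance the frame across an odd and then an even crease. *)
Lemma half_turn_cos_chebT (R : realType) (n : nat) (V : origami_vertex R (2 * n))
    (theta : R) (hV : forall i, sector_angle V i = theta) (sin_theta : 0 < sin theta)
    (f : 'rV[R]_2 -> 'rV[R]_3) (rf : rigid_folded_state V f) (a b : R)
    (hab : forall i : 'I_(2 * n), is_fold_angle V f i (if odd i then b else a)) :
  (chebT R n).[half_turn_cos theta a b] ^+ 2 = 1.
Proof.
have [->|n0] := posnP n; first by rewrite hornerC expr1n.
pose q rho := fold_quat (cos (theta / 2)) (sin (theta / 2)) (cos (rho / 2)) (sin (rho / 2)).
have q1 rho : qnorm2 (q rho) = 1 by apply: qnorm2_fold_quat; rewrite cos2Dsin2.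
(* From an even sector the odd crease, with angle [b], is crossed first; its rotation is therefore
   the right factor. *)
pose Q := qmul (q a) (q b).
have Q1 : qnorm2 Q = 1 by rewrite qnorm2M !q1 mulr1.
have <- : qre Q = half_turn_cos theta a b.
  rewrite /half_turn_cos (cos_half theta) /=.
  transitivity ((cos (theta / 2) ^+ 2 - sin (theta / 2) ^+ 2) * cos (a / 2) * cos (b / 2)
     - sin (a / 2) * sin (b / 2) * (cos (theta / 2) ^+ 2 + sin (theta / 2) ^+ 2)).
    by ring.
  by rewrite cos2Dsin2 mulr1.
rewrite -qre_exp //.
have stepF k : (k < 2 * n)%N -> sector_frame theta f k.+1 =
    rotmx (q (if odd k then a else b)) *m sector_frame theta f k.
  move=> kn; have := sector_frameS hV sin_theta rf (hab (ordS (Ordinal kn))).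
  rewrite (_ : odd _ = ~~ odd k); first by case: odd.
  rewrite /=; move: kn; rewrite leq_eqVlt => /orP[/eqP e|h].
    (* At the wrap-around the next crease is crease 0, whose parity is right because the number of
       creases is even. *)
    by rewrite e modnn -[~~ odd k]/(odd k.+1) e mul2n odd_double.
  by rewrite modn_small.
have powF k : (k <= n)%N -> sector_frame theta f (2 * k) =
    rotmx (qexp Q k) *m sector_frame theta f 0.
  elim: k => [|k IH] kn; first by rewrite muln0 rotmx1 mul1mx.
  have -> : qexp Q k.+1 = qmul Q (qexp Q k) by [].
  rewrite mulnS add2n stepF ?stepF; try by lia.
  have -> : odd (2 * k).+1 = true by rewrite oddS oddM.
  have -> : odd (2 * k) = false by rewrite oddM.
  rewrite (IH (ltnW kn)).
  by rewrite rotmxM rotmxM !mulmxA.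
(* Frame [2 * n] is frame 0 again, so the rotation of the [n]-th power of [Q] fixes the initial
   frame. *)
have := powF n (leqnn n); rewrite -[(2 * n)%N]add0n /sector_frame.
rewrite (crease_image_period hV) (normal_image_period hV) => fixF.
have m0 : (0 < 2 * n)%N by rewrite muln_gt0.
have [uu vv uv] := crease_image_dots hV rf (Ordinal m0).
apply: qre_frame_fixed fixF => //.
- exact: qnorm2X.
- rewrite /normal_image !(dotvZl, dotvZr) dotv_crossv_crossv uu vv uv cos2sin2.
  by field; rewrite gt_eqF.
- by rewrite /normal_image dotvZr dotvC dotv_crossvl mulr0.
Qed.

(** * The constant half-turn cosine *)

Lemma cos_quarter_gt0 (R : realType) (x : R) : - pi <= x <= pi -> 0 < cos (x / 4).
Proof. by have := pi_gt0 R => p0 h; apply: cos_gt0_pihalf; lra. Qed.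

(** In sines and cosines of quarter angles the equation factors into two linear relations. Quarter
    angles have positive cosine, which allows division back to tangents. *)
Lemma half_turn_cos_tan (R : realType) (theta a b : R) :
  0 < theta < pi -> - pi <= a <= pi -> - pi <= b <= pi ->
  half_turn_cos theta a b = cos theta ->
  let p := (1 - tan (theta / 2)) / (1 + tan (theta / 2)) in
  tan (b / 4) = - p * tan (a / 4) \/ tan (a / 4) = - p * tan (b / 4).
Proof.
move=> th /cos_quarter_gt0 + /cos_quarter_gt0 + w p.
have c0 : 0 < cos (theta / 2) by apply: cos_gt0_pihalf; lra.
have s0 : 0 < sin (theta / 2) by apply: sin_gt0_pihalf; lra.
have pE : p = (cos (theta / 2) - sin (theta / 2)) / (cos (theta / 2) + sin (theta / 2)).
  by rewrite /p /tan; field; rewrite !gt_eqF //= addr_gt0.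
move: w; rewrite pE /half_turn_cos (cos_half theta) (cos_half (a / 2)) (cos_half (b / 2)).
rewrite (sin_half (a / 2)) (sin_half (b / 2)) /tan.
have q x : x / 2 / 2 = x / 4 :> R by field.
rewrite !q.
have := cos2Dsin2 (a / 4); have := cos2Dsin2 (b / 4); have := cos2Dsin2 (theta / 2).
move: (cos (a / 4)) (sin (a / 4)) (cos (b / 4)) (sin (b / 4)) c0 s0.
move: (cos (theta / 2)) (sin (theta / 2)) => c s Ca Sa Cb Sb c0 s0 cs1 b1 a1 w Ca0 Cb0.
have cs0 : 0 < c + s by rewrite addr_gt0.
have fact0 : ((c + s) * (Ca * Sb) + (c - s) * (Sa * Cb)) *
    ((c + s) * (Sa * Cb) + (c - s) * (Ca * Sb)) = 0.
  transitivity ((c ^+ 2 - s ^+ 2) * (Ca ^+ 2 * Sb ^+ 2 + Sa ^+ 2 * Cb ^+ 2)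
     + 2 * (c ^+ 2 + s ^+ 2) * (Ca * Sa * Cb * Sb)); first by ring.
  (* Homogenising [cos theta] in this way and subtracting [w] from it yields twice the required
     expression. *)
  have : (c ^+ 2 - s ^+ 2) * ((Ca ^+ 2 + Sa ^+ 2) * (Cb ^+ 2 + Sb ^+ 2)) =
         c ^+ 2 - s ^+ 2 by rewrite a1 b1 !mulr1.
  rewrite cs1; move: w; move: (c ^+ 2 - s ^+ 2) => d; lra.
(* The two factors differ only by exchanging the two fold angles, so one division treats both. *)
have solve (x y X Y : R) : 0 < X -> 0 < Y ->
    (c + s) * (X * y) + (c - s) * (x * Y) = 0 -> y / Y = - ((c - s) / (c + s)) * (x / X).
  move=> X0 Y0 h; apply/eqP; rewrite -subr_eq0; apply/eqP.
  transitivity (((c + s) * (X * y) + (c - s) * (x * Y)) / ((c + s) * X * Y)).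
    by field; rewrite !gt_eqF.
  by rewrite h mul0r.
move/eqP: fact0; rewrite mulf_eq0 => /orP[] /eqP h; [left|right]; apply: solve => //.
by rewrite -h; ring.
Qed.

Lemma continuous_half_turn_cos (R : realType) (theta : R) (A : set R) (a b : R -> R) :
  {within A, continuous a} -> {within A, continuous b} ->
  {within A, continuous (fun t => half_turn_cos theta (a t) (b t))}.
Proof.
move=> ca cb x.
have half (u : R -> R) : {within A, continuous u} -> forall g : R -> R, continuous g ->
    (fun t : subspace A => g (u t / 2)) @ x --> g (u x / 2).
  move=> cu g cg; apply: (continuous_comp (f := fun t : subspace A => u t / 2)); last exact: cg.
  by apply: cvgMr_tmp; exact: cu.
apply: cvgB; apply: cvgM; first apply: cvgMl_tmp.
- exact: half ca _ (@continuous_cos R).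
- exact: half cb _ (@continuous_cos R).
- exact: half ca _ (@continuous_sin R).
- exact: half cb _ (@continuous_sin R).
Qed.

Unset Implicit Arguments.
Set Strict Implicit.

Theorem mainTheorem4 (R : realType) (n : nat) (hn : (2 <= n)%N)
    (V : origami_vertex R (2 * n))
    (hV : forall i, sector_angle V i = pi / n%:R)
    (gamma : R -> 'rV[R]_(2 * n))
    (hmotion : rigid_folding_motion V gamma)
    (hflat : gamma 0 = 0)
    (hsym : forall t, 0 <= t <= 1 -> forall i j : 'I_(2 * n),
       i = j %[mod 2] -> gamma t 0 i = gamma t 0 j) :
  let p : R :=
    (1 - tan (pi / (2 * n%:R))) / (1 + tan (pi / (2 * n%:R))) in
  forall t, 0 <= t <= 1 ->
  exists rho_a rho_b : R,
    ((forall i : 'I_(2 * n), gamma t 0 i = if odd i then rho_b else rho_a) \/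
     (forall i : 'I_(2 * n), gamma t 0 i = if odd i then rho_a else rho_b)) /\
    tan (rho_b / 4) = - p * tan (rho_a / 4).
Proof.
move=> p t t01; have [gc gs] := hmotion.
have lt0 : (0 < 2 * n)%N by lia.
have lt1 : (1 < 2 * n)%N by lia.
pose a s := gamma s 0 (Ordinal lt0); pose b s := gamma s 0 (Ordinal lt1).
have gE s : 0 <= s <= 1 -> forall i : 'I_(2 * n), gamma s 0 i = if odd i then b s else a s.
  move=> s01 i; case: (boolP (odd i)) => oi; apply: hsym => //=.
    by rewrite modn2 oi.
  by rewrite modn2 (negbTE oi).
set theta : R := pi / n%:R.
have n0 : 0 < n%:R :> R by rewrite ltr0n; lia.
have thpi : 0 < theta < pi.
  by rewrite divr_gt0 ?pi_gt0 //= ltr_pdivrMr // ltr_pMr ?pi_gt0 // ltr1n.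
have st0 : 0 < sin theta by exact: sin_gt0_pi.
pose w s := half_turn_cos theta (a s) (b s).
(* At every time [w] is a root of one fixed nonzero polynomial, which will force it to be
   constant. *)
have wroot s : 0 <= s <= 1 -> (chebT R n ^+ 2 - 1).[w s] = 0.
  move=> s01; have [f rf hf] := gs s s01.
  have hab i : is_fold_angle V f i (if odd i then b s else a s) by rewrite -gE.
  by rewrite !hornerE (half_turn_cos_chebT hV st0 rf hab) subrr.
have [t0 t1] := andP t01.
(* Constancy is needed only between the flat state and time [t], so continuity is restricted to that
   interval. *)
have coordc i : {within `[0, t], continuous (fun s => gamma s 0 i)}.
  have gct : {within `[0, t], continuous gamma}.
    apply: continuous_subspaceW gc => x /=; rewrite !in_itv /= => /andP[-> xt].
    exact: le_trans xt t1.
  move=> x; apply: (continuous_comp (g := fun M : 'rV[R]_(2 * n) => M 0 i)).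
    exact: gct.
  exact: coord_continuous.
have wt : w t = cos theta.
  have <- : w 0 = w t.
    apply: continuous_poly_root_const t0 (chebT_sqr_neq1 R (ltnW hn)) _ _.
      exact: continuous_half_turn_cos (coordc _) (coordc _).
    by move=> x /andP[x0 xt]; apply: wroot; rewrite x0 (le_trans xt t1).
  by rewrite /w /a /b hflat !mxE /half_turn_cos !mul0r cos0 sin0; ring.
have bound i : - pi <= gamma t 0 i <= pi.
  by have [f _ hf] := gs t t01; have [] := hf i.
have pE : pi / (2 * n%:R) = theta / 2 by rewrite /theta; field; rewrite gt_eqF.
have := half_turn_cos_tan thpi (bound (Ordinal lt0)) (bound (Ordinal lt1)) wt.
(* The factor that vanishes at time [t] decides which parity class is named [rho_a]. *)
rewrite -pE -/p => -[h|h].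
  by exists (a t), (b t); split => //; left; exact: gE.
by exists (b t), (a t); split => //; right; exact: gE.
Qed.
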